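(* For every positive integer $m$, the constant term $d_0(m)$ of $P_m(a)$ satisfies $\nu_2(d_0(m)) = -(m + \nu_2(m!)) = s_2(m) - 2m$.
   Context: For a positive integer $m$ and real $a > -1$, let $N_{0,4}(a;m) = \int_0^\infty \frac{dx}{(x^4+2ax^2+1)^{m+1}}$. The function $P_m(a) = \frac{2^{m+3/2}}{\pi}(a+1)^{m+1/2} N_{0,4}(a;m)$ is a polynomial of degree $m$ in $a$ with rational coefficients; write $P_m(a) = \sum_{l=0}^m d_l(m) a^l$. $\nu_2$ denotes the $2$-adic valuation of a nonzero rational number, and $s_2(m)$ is the sum of the binary digits of $m$. *)

(* Defs.v *)
(* MathComp / MathComp-Analysis *)
From mathcomp Require Import all_boot all_order all_algebra.
From mathcomp Require Import all_classical all_reals all_analysis.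

Set Implicit Arguments.
Unset Strict Implicit.
Unset Printing Implicit Defensive.

Import Order.TTheory GRing.Theory Num.Theory.
Import numFieldNormedType.Exports.

Local Open Scope classical_set_scope.
Local Open Scope ring_scope.

(* The integrand is positive on [0, +oo[ when a > -1, so the Lebesgue integral
   is the improper integral; it is finite there, hence [Rintegral] (which sends
   +oo to 0) loses nothing. *)
Definition N04 (R : realType) (a : R) (m : nat) : R :=
  \int[@lebesgue_measure R]_(x in `[0, +oo[)
    ((x ^+ 4 + 2 * a * x ^+ 2 + 1) ^+ m.+1)^-1.

Definition P (R : realType) (m : nat) (a : R) : R :=
  2 `^ (m%:R + 3 / 2) / pi * (a + 1) `^ (m%:R + 1 / 2) * N04 a m.

(* Values on ]-1, +oo[ determine a polynomial, so at most one p qualifies.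
   The default 0 is irrelevant for m > 0, where such a p (of degree m) exists. *)
Definition Ppoly (R : realType) (m : nat) : {poly rat} :=
  xget 0 [set p : {poly rat} |
    forall a : R, -1 < a -> P m a = (map_poly ratr p).[a]].

Definition d (R : realType) (l m : nat) : rat := (Ppoly R m)`_l.

(* For q = 0 this gives the junk value 0 instead of +oo. *)
Definition nu (p : nat) (q : rat) : int :=
  (logn p `|numq q|%N)%:Z - (logn p `|denq q|%N)%:Z.

(* Since m < 2 ^ m, the binary digits of m in positions i >= m all vanish. *)
Definition s2 (m : nat) : nat := (\sum_(i < m) (m %/ 2 ^ i) %% 2)%N.

(* Main.v *)
Require Import Defs.
From mathcomp Require Import all_boot all_order all_algebra.
From mathcomp Require Import all_classical all_reals all_analysis.
From mathcomp Require Import ring lra zify.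

Import Order.TTheory GRing.Theory Num.Theory.
Import numFieldNormedType.Exports.
Local Open Scope classical_set_scope.
Local Open Scope ring_scope.

(* Write Q(x) = x^4 + 2ax^2 + 1 and c = 2(a + 1); when xy = 1 one has
   Q(x) = x^2 ((x - y)^2 + c). Folding [1, +oo[ onto ]0, 1] by x -> 1/x and
   putting u = x - 1/x turns N_{0,4}(a; m) into the integral over [0, +oo[ of
   T(u^2) / (u^2 + c)^(m+1), where T is the rational polynomial of degree m with
   x^(2m+1) + x^-(2m+1) = (x + 1/x) T((x - 1/x)^2). Wallis-type reductions
   evaluate it as pi c^(-m-1/2) times a rational polynomial in c, so P_m is a
   rational polynomial and d_0(m) = P_m(0). At a = 0, integrating the derivative
   of x / (x^4 + 1)^(m+1) gives N(0; m+1) = (4m+3)/(4m+4) N(0; m), hence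
   d_0(m) = prod_(j < m) (4j + 3) / (2^m m!), a fraction with odd numerator;
   Legendre's formula does the rest. *)

(** * Integrals over the half-line, handled through primitives *)

(** Encoding the integral of [g] by a primitive reduces linearity and substitution to
    differentiation. The derivative is asked for on [A]: all of R for integrals in u, since u = x -
    1/x is negative for x < 1, but only [0, +oo[ for the quartic. *)
Definition improper {R : realType} (A : set R) (g : R -> R) (l : R) :=
  exists F : R -> R, [/\ forall x, A x -> is_derive x 1 F (g x),
    F 0 = 0 & F x @[x --> +oo] --> l].

Section Improper.
Context {R : realType}.
Implicit Types (A : set R) (f g : R -> R) (k l : R).

Lemma eq_improper A f g l :
  (forall x, A x -> f x = g x) -> improper A f l -> improper A g l.
Proof.
move=> fg [F [dF F0 Fl]]; exists F; split=> // x Ax.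
by apply: is_derive_eq (fg _ Ax); exact: dF.
Qed.

Lemma improperZ A k f l :
  improper A f l -> improper A (fun x => k * f x) (k * l).
Proof.
move=> [F [dF F0 Fl]]; exists (fun x => k * F x); split.
- by move=> x Ax; have dFx := dF x Ax; exact: is_deriveZ.
- by rewrite F0 mulr0.
- exact: cvgMr.
Qed.

Lemma improperD A f g k l : improper A f k -> improper A g l ->
  improper A (fun x => f x + g x) (k + l).
Proof.
move=> [F [dF F0 Fk]] [G [dG G0 Gl]]; exists (fun x => F x + G x); split.
- move=> x Ax; have dFx := dF x Ax; have dGx := dG x Ax; exact: is_deriveD.
- by rewrite F0 G0 addr0.
- exact: cvgD.
Qed.

Lemma improper_sum A n (f : 'I_n -> R -> R) (l : 'I_n -> R) :
  (forall i, improper A (f i) (l i)) ->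
  improper A (fun x => \sum_(i < n) f i x) (\sum_(i < n) l i).
Proof.
elim: n f l => [|n IHn] f l fl.
  rewrite big_ord0; exists (fun=> 0); split => //; last exact: cvg_cst.
  by move=> x _; rewrite big_ord0; exact: is_derive_cst.
rewrite big_ord_recr /=; under eq_fun do rewrite big_ord_recr /=.
by apply: improperD; [apply: IHn | apply: fl].
Qed.

(** The bridge back to the Lebesgue integral: for nonnegative continuous [g] the fundamental theorem
    holds on a half-line. *)
Lemma improper_Rintegral g l :
  (forall x, 0 <= x -> 0 <= g x) -> continuous g ->
  improper [set x | 0 <= x] g l ->
  \int[@lebesgue_measure R]_(x in `[0, +oo[) g x = l.
Proof.
move=> g0 cg [F [dF F0 Fl]].
rewrite (@Rintegral_ge0_continuous_FTC2y _ g F 0 l) ?F0 ?subr0//.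
- exact: continuous_subspaceT.
- by move=> x /ltW x0; have dFx := dF _ x0; exact: ex_derive.
- apply: cvg_at_right_filter; rewrite -[X in _ --> X]F0.
  apply: differentiable_continuous; apply/derivable1_diffP.
  by have dF0 := dF 0 (lexx _); exact: ex_derive.
- move=> x; rewrite in_itv/= andbT => /ltW x0; rewrite derive1E.
  by have dFx := dF _ x0; exact: derive_val.
Qed.

Lemma is_derive1X f n (x df : R) : is_derive x 1 f df ->
  is_derive x 1 (fun y => f y ^+ n) (n%:R * f x ^+ n.-1 * df).
Proof. by move=> dfx; rewrite -exprfctE; exact: is_deriveX. Qed.

Lemma is_derive1_quot f g (x df dg : R) : g x != 0 ->
  is_derive x 1 f df -> is_derive x 1 g dg ->
  is_derive x 1 (fun y => f y / g y) ((df * g x - f x * dg) / g x ^+ 2).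
Proof.
move=> gx0 fx gx; have gVx := is_deriveV gx0 gx.
apply: (@is_derive_eq _ _ _ _ _ _ _ _ (is_deriveM fx gVx)).
by rewrite /GRing.scale/=; field.
Qed.

Lemma cvgy0_le_inv f :
  (forall x, 1 <= x -> 0 <= f x <= x^-1) -> f x @[x --> +oo] --> 0.
Proof.
move=> fb; apply: (@squeeze_cvgr _ _ _ _ (cst 0) (fun x : R => x^-1)).
- near=> x; apply: fb; near: x; exact: nbhs_pinfty_ge.
- exact: cvg_cst.
- apply/gtr0_cvgV0; last exact: cvg_id.
  near=> x; near: x; exact: nbhs_pinfty_gt.
Unshelve. all: by end_near. Qed.

Lemma improper_inv_sqrDc (c : R) : 0 < c ->
  improper setT (fun u => (u ^+ 2 + c)^-1) (pi / 2 / Num.sqrt c).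
Proof.
move=> c0; have s0 : 0 < Num.sqrt c by rewrite sqrtr_gt0.
exists (fun u => atan (u / Num.sqrt c) / Num.sqrt c); split.
- move=> u _.
  have d1 : is_derive u 1 (fun v => v * (Num.sqrt c)^-1) (1 / Num.sqrt c).
    have := @is_deriveZ _ _ _ id (Num.sqrt c)^-1 u 1 1 (is_derive_id _ _).
    by under [X in is_derive _ _ X]eq_fun => v do rewrite /GRing.scale/= mulrC;
      move=> h; apply: is_derive_eq h _; rewrite /GRing.scale/= mulrC.
  have d2 := @is_derive1_comp _ atan _ _ _ _ (is_derive1_atan _) d1.
  have := @is_deriveZ _ _ _ _ (Num.sqrt c)^-1 u 1 _ d2.
  under [X in is_derive _ _ X]eq_fun => v do rewrite /GRing.scale/= mulrC.
  move=> h; apply: is_derive_eq h _; rewrite /GRing.scale/=.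
  rewrite -[X in _ = (_ + X)^-1](sqr_sqrtr (ltW c0)); field.
  by rewrite !gt_eqF// ltr_wpDl ?sqr_ge0 ?exprn_gt0.
- by rewrite mul0r atan0 mul0r.
- apply: cvgMl; apply: cvg_comp; last exact: cvgy_atan.
  apply: gt0_cvgMly => //; rewrite ?invr_gt0//; exact: cvg_id.
Qed.

End Improper.

(** * Wallis-type integrals and the folding polynomial *)

Section Reduction.
Context {R : realType}.

(* The integrand is the derivative of u^(2k+1) / (u^2 + c)^(m+1). *)
Lemma improper_boundary (c : R) (k m : nat) : 0 < c -> (k <= m)%N ->
  improper setT (fun u : R =>
    (k.*2.+1)%:R * (u ^+ k.*2 / (u ^+ 2 + c) ^+ m.+1) +
    - (m.+1.*2)%:R * (u ^+ k.+1.*2 / (u ^+ 2 + c) ^+ m.+2)) 0.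
Proof.
move=> c0 km.
have B0 (u : R) : 0 < u ^+ 2 + c by rewrite ltr_wpDl ?sqr_ge0.
exists (fun u => u ^+ k.*2.+1 / (u ^+ 2 + c) ^+ m.+1); split.
- move=> u _.
  have dB : is_derive u 1 (fun v : R => v ^+ 2 + c) (2%:R * u).
    have h := is_deriveD (is_derive1X _ 2 _ _ (is_derive_id u 1))
      (is_derive_cst c u 1).
    by apply: is_derive_eq h _; rewrite addr0 mulr1.
  have dn := is_derive1X _ k.*2.+1 _ _ (is_derive_id u 1).
  have dd := is_derive1X _ m.+1 _ _ dB.
  apply: is_derive_eq (is_derive1_quot _ _ _ _ _ _ dn dd) _.
    by rewrite expf_neq0// gt_eqF.
  rewrite mulr1 [_.-1]/= [_.+1.-1]/= [k.+1.*2]doubleS -[m.+1.*2]muln2 natrM.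
  move: (B0 u); set B := _ + c => /gt_eqF Bn0; rewrite !exprSr !expr0 !mul1r.
  have Bm : B ^+ m != 0 by rewrite expf_neq0// Bn0.
  move: (B ^+ m) (u ^+ k.*2) (k.*2.+1%:R : R) (m.+1%:R : R) Bm => b p K M bn0.
  by field; rewrite bn0 Bn0.
- by rewrite exprS !mul0r.
(* As k <= m and x >= 1, x^(2k+2) <= (x^2)^(m+1) <= (x^2 + c)^(m+1), so the primitive is at most
   1/x. *)
- apply: cvgy0_le_inv => x x1.
  have x0 : 0 < x by exact: lt_le_trans x1.
  rewrite divr_ge0 ?exprn_ge0 ?(ltW x0) ?(ltW (B0 x))//=.
  rewrite ler_pdivrMr ?exprn_gt0// ler_pdivlMl// -exprS -doubleS -mul2n exprM.
  apply: (@le_trans _ _ ((x ^+ 2) ^+ m.+1)).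
    by rewrite ler_weXn2l// ?exprn_ege1.
  by rewrite lerXn2r ?nnegrE ?sqr_ge0 ?(ltW c0) ?(ltW (B0 x))// lerDl ltW.
Qed.

(* The integral of u^(2k) / (u^2 + c)^(m+1) over [0, +oo[ is
   wallis k m * pi * c^(k-m-1/2) for k <= m; other values are junk. *)
Fixpoint wallis (k m : nat) : rat :=
  match m, k with
  | 0, _ => 2^-1
  | m'.+1, 0 => (m'.*2.+1)%:R / (m.*2)%:R * wallis 0 m'
  | m'.+1, k'.+1 => (k'.*2.+1)%:R / (m.*2)%:R * wallis k' m'
  end.

(** Induction on m, adding to the integral known for m a multiple of the boundary identity, whose
    integral is 0. *)
Lemma improper_wallis (c : R) (k m : nat) : 0 < c -> (k <= m)%N ->
  improper setT (fun u : R => u ^+ k.*2 / (u ^+ 2 + c) ^+ m.+1)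
    (ratr (wallis k m) * pi * c ^+ k / (c ^+ m * Num.sqrt c)).
Proof.
move=> c0; have s0 : Num.sqrt c != 0 by rewrite gt_eqF// sqrtr_gt0.
have cn0 : c != 0 by rewrite gt_eqF.
have B0 (u : R) : u ^+ 2 + c != 0 by rewrite gt_eqF// ltr_wpDl ?sqr_ge0.
elim: m k => [|m IHm] [|k]//.
- move=> _; rewrite /= fmorphV/= ratr_nat.
  have := improper_inv_sqrDc c c0.
  rewrite !expr0 mulr1 mul1r [2^-1 * pi]mulrC.
  by apply: eq_improper => u _; rewrite mul1r expr1.
- move=> _.
  have h1 := IHm 0 (leq0n _).
  have h2 := improper_boundary c 0 m c0 (leq0n _).
  (* The coefficients come from c = (u^2 + c) - u^2: the u^2 term is removed by the boundary
     identity with k = 0. *)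
  have := improperD _ _ _ _ _
    (improperZ _ ((m.*2.+1)%:R / (m.+1.*2)%:R / c) _ _ h1)
    (improperZ _ ((m.+1.*2)%:R * c)^-1 _ _ h2).
  have -> : ratr (wallis 0 m.+1) =
      (m.*2.+1)%:R / (m.+1.*2)%:R * ratr (wallis 0 m) :> R.
    by rewrite [wallis 0 _]/= !rmorphM/= fmorphV/= !ratr_nat.
  have cm : c ^+ m != 0 by rewrite expf_neq0.
  have m1 : m.+1%:R != 0 :> R by rewrite pnatr_eq0.
  have m2 : m.+1.*2%:R != 0 :> R by rewrite pnatr_eq0.
  set w := ratr _; rewrite !mulr0 addr0.
  have -> : m.*2.+1%:R / m.+1.*2%:R / c *
      (w * pi * c ^+ 0 / (c ^+ m * Num.sqrt c)) =
     (m.*2.+1)%:R / (m.+1.*2)%:R * w * pi * c ^+ 0 / (c ^+ m.+1 * Num.sqrt c).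
    by rewrite [c ^+ m.+1]exprS; field; rewrite s0 cn0 cm m2.
  apply: eq_improper => u _.
  have Bm : (u ^+ 2 + c) ^+ m != 0 by rewrite expf_neq0.
  rewrite [(_ + c) ^+ m.+2]exprS [(_ + c) ^+ m.+1]exprS expr0.
  rewrite (_ : 1.*2 = 2%N)// double0 mul1r.
  have -> : m.*2.+1%:R = m.+1.*2%:R - 1 :> R.
    by rewrite doubleS -[_.+2%:R]natr1 addrK.
  move: (B0 u) (m.+1.*2%:R : R) Bm m2 => Bu M; move: (_ ^+ m) => b bn0 M0.
    by field; rewrite Bu cn0 bn0 M0.
- rewrite ltnS => km.
  have h1 := IHm k km.
  have h2 := improper_boundary c k m c0 km.
  (* Integration by parts: the boundary identity is solved for its second term. *)
  have := improperD _ _ _ _ _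
    (improperZ _ ((k.*2.+1)%:R / (m.+1.*2)%:R) _ _ h1)
    (improperZ _ (- (m.+1.*2)%:R^-1) _ _ h2).
  have -> : ratr (wallis k.+1 m.+1) =
      (k.*2.+1)%:R / (m.+1.*2)%:R * ratr (wallis k m) :> R.
    by rewrite [wallis k.+1 _]/= !rmorphM/= fmorphV/= !ratr_nat.
  have cm : c ^+ m != 0 by rewrite expf_neq0.
  have m2 : m.+1.*2%:R != 0 :> R by rewrite pnatr_eq0.
  set w := ratr _; rewrite !mulr0 addr0.
  have -> : k.*2.+1%:R / m.+1.*2%:R *
      (w * pi * c ^+ k / (c ^+ m * Num.sqrt c)) =
     (k.*2.+1)%:R / (m.+1.*2)%:R * w * pi * c ^+ k.+1 /
      (c ^+ m.+1 * Num.sqrt c).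
    by rewrite ![c ^+ _.+1]exprS; field; rewrite s0 cn0 cm m2.
  apply: eq_improper => u _.
  have Bm : (u ^+ 2 + c) ^+ m.+1 != 0 by rewrite expf_neq0.
  have Bm' : (u ^+ 2 + c) ^+ m.+2 != 0 by rewrite expf_neq0.
  set p := u ^+ _ / _; set q := u ^+ _ / _.
  by field.
Qed.

(** Since x^2 + y^2 = (x - y)^2 + 2, the polynomials obey T_0 = 1, T_1 = X + 1, T_(n+2) = (X + 2)
    T_(n+1) - T_n (Morgan-Voyce polynomials); hence an induction on consecutive pairs. *)
Lemma odd_power_sum (m : nat) : exists T : {poly rat}, (size T <= m.+1)%N /\
  forall x y : R, x * y = 1 ->
    x ^+ m.*2.+1 + y ^+ m.*2.+1 = (x + y) * (map_poly ratr T).[(x - y) ^+ 2].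
Proof.
pose S n := exists T : {poly rat}, (size T <= n.+1)%N /\
  forall x y : R, x * y = 1 ->
    x ^+ n.*2.+1 + y ^+ n.*2.+1 = (x + y) * (map_poly ratr T).[(x - y) ^+ 2].
suff [] : S m /\ S m.+1 by [].
elim: m => [|m [[T [sT TE]] [U [sU UE]]]].
  split.
    exists 1; split; first by rewrite size_poly1.
    by move=> x y _; rewrite rmorph1 hornerC mulr1 !expr1.
  exists ('X + 1%:P); split; first by rewrite size_XaddC.
  move=> x y xy; rewrite rmorphD/= map_polyX map_polyC/= rmorph1.
  rewrite hornerE/= hornerX hornerC.
  rewrite /=; transitivity ((x + y) * ((x - y)^+2 + x * y)); last by rewrite xy.
  by ring.
split; first by exists U.
exists (('X + 2%:P) * U - T); split.
  rewrite (leq_trans (size_polyD _ _))// geq_max size_polyN.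
  rewrite (leq_trans sT (leqW (leqnSn _))) andbT.
  by apply: (leq_trans (size_polyMleq _ _)); rewrite size_XaddC; exact: sU.
move=> x y xy; rewrite rmorphB rmorphM rmorphD/= map_polyX map_polyC/= ratr_nat.
rewrite hornerD hornerN hornerM hornerD hornerX hornerC.
rewrite mulrBr mulrCA -UE// -TE//.
have -> : (x - y) ^+ 2 + 2 = x ^+ 2 + y ^+ 2 + 2 * (1 - x * y) by ring.
rewrite xy subrr mulr0 addr0.
(* Inserting (xy)^2 = 1 makes the identity homogeneous, hence valid for all x and y. *)
have -> : x ^+ m.*2.+1 = x ^+ m.*2.+1 * (x * y)^+2 by rewrite xy expr1n mulr1.
have -> : y ^+ m.*2.+1 = y ^+ m.*2.+1 * (x * y)^+2 by rewrite xy expr1n mulr1.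
rewrite !doubleS !exprS; ring.
Qed.

End Reduction.

(** * The quartic integral and the polynomial P_m *)

Section Quartic.
Context {R : realType}.

Lemma primitive_ge0 (g : R -> R) : continuous g ->
  exists F : R -> R, F 0 = 0 /\ forall x : R, 0 <= x -> is_derive x 1 F (g x).
Proof.
(* Starting at -1 keeps 0 interior, so the derivative at 0 is two-sided. *)
move=> cg; pose F x : R := \int[@lebesgue_measure R]_(t in `[-1, x]) g t.
exists (fun x => F x - F 0); split=> [|x x0]; first by rewrite subrr.
have gi : (@lebesgue_measure R).-integrable `[-1, x + 1] (EFin \o g).
  apply: continuous_compact_integrable; first exact: segment_compact.
  exact: continuous_subspaceT.
have [] := @continuous_FTC1 R g (BLeft (-1)) x (x + 1) _ gi _ (cg x).
- by rewrite ltrDl.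
- by rewrite lte_fin; lra.
rewrite -/F => dF F'; have dFx : is_derive x 1 F (g x).
  by have dP := derivableP dF; apply: is_derive_eq dP _; rewrite -derive1E.
apply: is_derive_eq (is_deriveB dFx (is_derive_cst (F 0) x 1)) _.
by rewrite subr0.
Qed.

Lemma quartic_gt0 (a x : R) : -1 < a -> 0 < x ^+ 4 + 2 * a * x ^+ 2 + 1.
Proof.
move=> a1; have [->|x0] := eqVneq x 0; first by rewrite !expr0n/= mulr0 !add0r.
have -> : x ^+ 4 + 2 * a * x ^+ 2 + 1 =
    (x ^+ 2 - 1) ^+ 2 + 2 * (a + 1) * x ^+ 2.
  by ring.
have a0 : 0 < a + 1 by lra.
by rewrite ltr_wpDl ?sqr_ge0// mulr_gt0 ?exprn_even_gt0// mulr_gt0.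
Qed.

Lemma continuous_quarticV (a : R) n : -1 < a ->
  continuous (fun x : R => ((x ^+ 4 + 2 * a * x ^+ 2 + 1) ^+ n)^-1).
Proof.
move=> a1 x; apply: cvgV; first by rewrite expf_neq0// gt_eqF// quartic_gt0.
apply: (cvg_comp _ (fun y : R => y ^+ n) _ (@exprn_continuous _ n _)).
apply: cvgD; last exact: cvg_cst.
apply: cvgD; first exact: exprn_continuous.
by apply: cvgM; [exact: cvg_cst | exact: exprn_continuous].
Qed.

(** The extra factor x is dx/ds for x = e^s. Applied to (x, y) and (y, x), the formula gives equal
    denominators, and the numerators add up to the sum in [odd_power_sum]. *)
Lemma quartic_reciprocal (a x y : R) (m : nat) : x * y = 1 ->
  ((x ^+ 4 + 2 * a * x ^+ 2 + 1) ^+ m.+1)^-1 * x =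
  y ^+ m.*2.+1 / ((x - y) ^+ 2 + 2 * (a + 1)) ^+ m.+1.
Proof.
move=> xy; have x0 : x != 0.
  by apply: contra_eq_neq xy => ->; rewrite mul0r eq_sym oner_eq0.
have -> : x ^+ 4 + 2 * a * x ^+ 2 + 1 =
    x ^+ 2 * ((x - y) ^+ 2 + 2 * (a + 1)) +
    (1 - x * y) * (1 + x * y - 2 * x ^+ 2).
  by ring.
rewrite xy subrr mul0r addr0 exprMn invfM mulrAC; congr (_ / _).
rewrite -exprM mul2n doubleS exprS invfM mulrAC mulVf// mul1r -exprVn.
by rewrite -[x^-1]mulr1 -xy mulKf.
Qed.

(** For a primitive [F] of the left integrand, F(x) = G(x - 1/x) + F(1/x) on x > 0; as x tends to
    +oo the right side tends to l + F(0) = l. *)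
Lemma improper_quartic (a l : R) (m : nat) (T : {poly R}) : -1 < a ->
  (forall x y : R, x * y = 1 ->
     x ^+ m.*2.+1 + y ^+ m.*2.+1 = (x + y) * T.[(x - y) ^+ 2]) ->
  improper setT (fun u => T.[u ^+ 2] / (u ^+ 2 + 2 * (a + 1)) ^+ m.+1) l ->
  improper [set x | 0 <= x]
    (fun x => ((x ^+ 4 + 2 * a * x ^+ 2 + 1) ^+ m.+1)^-1) l.
Proof.
move=> a1 TE [G [dG G0 Gl]].
have [F [F0 dF]] := primitive_ge0 _ (continuous_quarticV a m.+1 a1).
exists F; split=> //.
(* Parametrising x = e^s makes the fold smooth on the whole line. *)
pose h s := F (expR s) - F (expR (- s)) - G (expR s - expR (- s)).
have dh (s : R) : is_derive s 1 h 0.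
  have xy : expR s * expR (- s) = 1 by rewrite expRN mulfV// gt_eqF// expR_gt0.
  have dx : is_derive s 1 expR (expR s) := is_derive_expR s.
  have dy : is_derive s 1 (fun t => expR (- t)) (- expR (- s)).
    have dN : is_derive s 1 (-%R : R -> R) (- 1) := is_deriveNid s 1.
    apply: is_derive_eq (is_derive1_comp (is_derive_expR (- s)) dN) _.
    by rewrite mulrN1.
  have dFx := is_derive1_comp (dF _ (expR_ge0 s)) dx.
  have dFy := @is_derive1_comp _ F (fun t => expR (- t)) s _ _
    (dF _ (expR_ge0 (- s))) dy.
  have dGxy := @is_derive1_comp _ G (fun t => expR t - expR (- t)) s _ _
    (dG _ I) (is_deriveB dx dy).
  apply: is_derive_eq (is_deriveB (is_deriveB dFx dFy) dGxy) _.
  have := TE _ _ xy.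
  rewrite mulrN opprK (quartic_reciprocal _ _ _ _ xy).
  rewrite mulrC in xy; rewrite (quartic_reciprocal _ _ _ _ xy).
  rewrite -[_ - expR s]opprB sqrrN -mulrDl addrC.
  by move=> ->; rewrite opprK -mulrA [X in X - _]mulrC subrr.
(* [h] is constant and vanishes at s = 0, that is, at x = 1. *)
have hE (x : R) : 0 < x -> F x = G (x - x^-1) + F x^-1.
  move=> x0; have := is_derive_0_is_cst (ln x) 0 dh.
  rewrite /h oppr0 expR0 !subrr G0 subr0 expRN lnK ?posrE//.
  by move/eqP; rewrite !subr_eq add0r => /eqP.
have F0c : F x @[x --> 0] --> 0.
  rewrite -[X in _ --> X]F0; apply: differentiable_continuous.
  by apply/derivable1_diffP; have dF0 := dF 0 (lexx _); exact: ex_derive.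
have inv0 : x^-1 @[x --> +oo] --> (0 : R).
  by apply: cvgy0_le_inv => x x1;
    rewrite lexx andbT invr_ge0 (le_trans ler01 x1).
have suby : x - x^-1 @[x --> +oo] --> (+oo : set_system R).
  apply/cvgryPge => A; near=> x.
  have x1 : 1 <= x by near: x; exact: nbhs_pinfty_ge.
  have : A + 1 <= x by near: x; apply: nbhs_pinfty_ge; exact: num_real.
  have : x^-1 <= 1 by rewrite invf_le1 ?(lt_le_trans ltr01 x1).
  lra.
rewrite -[l]addr0.
apply: (@cvg_trans _ ((G (x - x^-1) + F x^-1) @[x --> +oo])).
  by apply: near_eq_cvg; near=> x; rewrite -hE.
apply: cvgD; first exact: (cvg_comp _ _ suby Gl).
exact: (cvg_comp _ _ inv0 F0c).
Unshelve. all: by end_near. Qed.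

Lemma N04_improper (a l : R) (m : nat) : -1 < a ->
  improper [set x | 0 <= x]
    (fun x => ((x ^+ 4 + 2 * a * x ^+ 2 + 1) ^+ m.+1)^-1) l -> N04 a m = l.
Proof.
move=> a1; apply: improper_Rintegral; last exact: continuous_quarticV.
by move=> x _; rewrite invr_ge0 exprn_ge0// ltW// quartic_gt0.
Qed.

(** The folding polynomial is integrated monomial by monomial; its size bound keeps k <= m. The
    rational coefficients serve every a at once, which is what makes P_m a rational polynomial. *)
Lemma improper_quartic_wallis (m : nat) : exists c : nat -> rat,
  forall a : R, -1 < a ->
  improper [set x | 0 <= x]
    (fun x => ((x ^+ 4 + 2 * a * x ^+ 2 + 1) ^+ m.+1)^-1)
    (pi / ((2 * (a + 1)) ^+ m * Num.sqrt (2 * (a + 1))) *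
      \sum_(k < m.+1) ratr (c k) * (2 * (a + 1)) ^+ k).
Proof.
have [T [sT TE]] := @odd_power_sum R m.
exists (fun k => T`_k * wallis k m) => a a1.
have c0 : 0 < 2 * (a + 1) by rewrite mulr_gt0//; lra.
apply: (improper_quartic _ _ _ _ a1 TE).
have := improper_sum setT m.+1 _ _ (fun k : 'I_m.+1 =>
  improperZ _ (ratr T`_k) _ _ (improper_wallis _ k m c0 (ltn_ord k))).
set l1 := (X in improper _ _ X); set l2 := (X in _ -> improper _ _ X).
have -> : l1 = l2.
  rewrite /l1 /l2 mulr_sumr; apply: eq_bigr => k _; rewrite rmorphM/=.
  set s := (_ * Num.sqrt _)^-1; ring.
apply: eq_improper => u _.
rewrite (@horner_coef_wide _ m.+1); last by rewrite size_map_poly.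
rewrite mulr_suml; apply: eq_bigr => k _.
by rewrite coef_map/= mulrA -exprM mul2n.
Qed.

(** Regrouping the powers of 2 leaves a multiple of c^(m+1/2) with c = 2(a + 1), ready to cancel the
    same power in the integral. *)
Lemma P_N04 (m : nat) (a : R) : -1 < a ->
  P m a = 2 * (2 * (a + 1)) ^+ m * Num.sqrt (2 * (a + 1)) / pi * N04 a m.
Proof.
move=> a1; have a0 : 0 < a + 1 by lra.
have half (x : R) : 0 < x -> x `^ (m%:R + 1 / 2) = x ^+ m * Num.sqrt x.
  move=> x0; rewrite powRD; last by rewrite gt_eqF ?implybT.
  by rewrite powR_mulrn ?ltW// mul1r powR12_sqrt// ltW.
rewrite /P half// (_ : m%:R + 3 / 2 = m%:R + 1 / 2 + 1 :> R); last by field.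
rewrite powRD ?pnatr_eq0 ?implybT// half// powRr1// sqrtrM// exprMn.
by move: pi (pi_gt0 R) (N04 a m) => p /gt_eqF p0 z; field; rewrite p0.
Qed.

Lemma P_poly (m : nat) : exists p : {poly rat}, forall a : R, -1 < a ->
  P m a = (map_poly ratr p).[a].
Proof.
have [c cE] := improper_quartic_wallis m.
exists (\sum_(k < m.+1) (2 * c k) *: (2%:P * ('X + 1%:P)) ^+ k) => a a1.
have c0 : 0 < 2 * (a + 1) by rewrite mulr_gt0//; lra.
rewrite P_N04// (N04_improper _ _ _ a1 (cE a a1)) mulrA.
have -> : 2 * (2 * (a + 1)) ^+ m * Num.sqrt (2 * (a + 1)) / pi *
  (pi / ((2 * (a + 1)) ^+ m * Num.sqrt (2 * (a + 1)))) = 2.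
  have : Num.sqrt (2 * (a + 1)) != 0 by rewrite gt_eqF// sqrtr_gt0.
  have : (2 * (a + 1)) ^+ m != 0 by rewrite expf_neq0// gt_eqF.
  move: (_ ^+ m) (Num.sqrt _) pi (pi_gt0 R) => b s p /gt_eqF p0 b0 s0.
  by field; rewrite p0 b0 s0.
rewrite rmorph_sum/= horner_sum mulr_sumr; apply: eq_bigr => k _.
rewrite map_polyZ/= hornerZ rmorphM/= ratr_nat mulrA; congr (_ * _).
rewrite rmorphXn/= horner_exp rmorphM/= !map_polyC/= ratr_nat.
rewrite [map_poly _ (_ + _)]rmorphD/= map_polyX map_polyC/= rmorph1.
by rewrite hornerM hornerD !hornerC hornerX.
Qed.

Lemma N04_0S (m : nat) :
  N04 (0 : R) m.+1 = (4 * m + 3)%:R / (4 * m.+1)%:R * N04 (0 : R) m.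
Proof.
have a1 : -1 < 0 :> R by lra.
(* Used only to know that the integral has a primitive with a limit; the recurrence holds whatever
   the limit is. *)
have [c /(_ 0 a1) h] := improper_quartic_wallis m.
rewrite (N04_improper _ _ _ a1 h); apply: N04_improper => //.
have Q0 (x : R) : 0 < x ^+ 4 + 2 * 0 * x ^+ 2 + 1 by rewrite quartic_gt0.
(* The derivative of x / (x^4 + 1)^(m+1). *)
have hb : improper [set x : R | 0 <= x]
    (fun x => (4 * m.+1)%:R / (x ^+ 4 + 2 * 0 * x ^+ 2 + 1) ^+ m.+2 -
      (4 * m + 3)%:R / (x ^+ 4 + 2 * 0 * x ^+ 2 + 1) ^+ m.+1) 0.
  exists (fun x => x / (x ^+ 4 + 1) ^+ m.+1); split.
  - move=> x _; have := Q0 x; rewrite mulr0 mul0r addr0 => Qx.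
    have dQ : is_derive x 1 (fun v : R => v ^+ 4 + 1) (4%:R * x ^+ 3).
      have := is_deriveD (is_derive1X _ 4 _ _ (is_derive_id x 1))
        (is_derive_cst (1 : R) x 1).
      by move=> h0; apply: is_derive_eq h0 _; rewrite addr0 mulr1.
    have dQm := is_derive1X _ m.+1 _ _ dQ.
    apply: is_derive_eq (is_derive1_quot _ _ _ _ _ _ (is_derive_id x 1) dQm) _.
      by rewrite expf_neq0// gt_eqF.
    have -> : x * (m.+1%:R * (x ^+ 4 + 1) ^+ m.+1.-1 * (4 * x ^+ 3)) =
      (4 * m.+1)%:R * ((x ^+ 4 + 1) - 1) * (x ^+ 4 + 1) ^+ m.
      by rewrite natrM [_.+1.-1]/=; ring.
    have -> : (4 * m + 3)%:R = (4 * m.+1)%:R - 1 :> R.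
      by rewrite [(4 * m.+1)%N]mulnSr [(_ + 4)%N]addnS -[_.+1%:R]natr1 addrK.
    move: Qx; set B := _ + 1 => /gt_eqF Bn0; rewrite !exprSr !expr0 !mul1r.
    have Bm : B ^+ m != 0 by rewrite expf_neq0// Bn0.
    move: (B ^+ m) ((4 * m.+1)%:R : R) Bm => b K bn0.
    by field; rewrite bn0 Bn0.
  - by rewrite mul0r.
  - apply: cvgy0_le_inv => x x1; have x0 : 0 < x by exact: lt_le_trans x1.
    have Qx : 1 <= x ^+ 4 + 1 by rewrite lerDr exprn_ge0// ltW.
    rewrite divr_ge0 ?exprn_ge0 ?(ltW x0) ?(le_trans _ Qx)//=.
    rewrite ler_pdivrMr ?exprn_gt0 ?(lt_le_trans _ Qx)// ler_pdivlMl// -expr2.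
    apply: (@le_trans _ _ (x ^+ 4)); first by rewrite ler_weXn2l.
    apply: (@le_trans _ _ (x ^+ 4 + 1)); first by rewrite lerDl.
    by rewrite -[leLHS]expr1 ler_weXn2l.
have := improperD _ _ _ _ _
  (improperZ _ ((4 * m + 3)%:R / (4 * m.+1)%:R) _ _ h)
  (improperZ _ (4 * m.+1)%:R^-1 _ _ hb).
rewrite [_^-1 * 0]mulr0 addr0; apply: eq_improper => x _.
have := Q0 x; set B := _ + 1 => /gt_eqF Bn0.
have M0 : (4 * m.+1)%:R != 0 :> R by rewrite pnatr_eq0.
have Bm : B ^+ m.+1 != 0 by rewrite expf_neq0// Bn0.
have Bm' : B ^+ m.+2 != 0 by rewrite expf_neq0// Bn0.
move: (B ^+ m.+1) (B ^+ m.+2) ((4 * m.+1)%:R : R) Bm Bm' M0.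
move=> b b' M bn0 bn0' M0.
by field; rewrite bn0 bn0' M0.
Qed.

(** For exponent 1 the folding polynomial is 1, leaving the arctangent integral with c = 2. *)
Lemma N04_00 : N04 (0 : R) 0 = pi / 2 / Num.sqrt 2.
Proof.
have a1 : -1 < 0 :> R by lra.
apply: N04_improper => //; apply: (@improper_quartic _ _ 0 1 a1).
  by move=> x y _; rewrite hornerC mulr1 !expr1.
apply: eq_improper (improper_inv_sqrDc 2 _); last exact: ltr0n.
by move=> u _; rewrite hornerC add0r mulr1 mul1r expr1.
Qed.

Lemma P_at0 (m : nat) :
  P m (0 : R) = (\prod_(j < m) (4 * j + 3))%:R / (2 ^ m * m`!)%:R.
Proof.
have a1 : -1 < 0 :> R by lra.
elim: m => [|m IHm].
  rewrite P_N04// N04_00 add0r mulr1 big_ord0 fact0 invr1 mulr1.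
  have : Num.sqrt 2 != 0 :> R by rewrite gt_eqF// sqrtr_gt0.
  move: pi (pi_gt0 R) => p /gt_eqF p0 s0.
  by field; rewrite p0 s0.
rewrite big_ord_recr/= natrM.
have -> : (2 ^ m.+1 * m.+1`!)%:R = 2 * (m.+1)%:R * (2 ^ m * m`!)%:R :> R.
  by rewrite -!natrM factS expnS mulnACA.
(* The prefactor 2 * 2^m * sqrt 2 / pi doubles from m to m + 1, halving the denominator 4(m + 1) of
   [N04_0S]. *)
transitivity ((4 * m + 3)%:R / (2 * m.+1%:R) * P m (0 : R)).
  rewrite !P_N04// N04_0S exprS natrM.
  have M0 : m.+1%:R != 0 :> R by rewrite pnatr_eq0.
  move: pi (pi_gt0 R) (N04 _ m) => p /gt_eqF p0 z.
  move: (m.+1%:R : R) M0 => M M0.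
  by field; rewrite M0 p0.
by rewrite IHm [in RHS]invfM mulrACA [X in X * _]mulrC.
Qed.

End Quartic.

(** * The 2-adic valuation of the constant term *)

(** The fraction may be unreduced: cross-multiplying with the reduced form and taking [logn] gives
    the same difference. *)
Lemma nu_frac (p a b : nat) : prime p -> (0 < a)%N -> (0 < b)%N ->
  nu p (a%:R / b%:R) = (logn p a)%:Z - (logn p b)%:Z.
Proof.
move=> pp a0 b0; set q : rat := _ / _.
have b0' : b%:R != 0 :> rat by rewrite pnatr_eq0 -lt0n.
have qb : q * b%:R = a%:R by rewrite mulfVK.
have q0 : 0 < q by rewrite divr_gt0// ltr0n.
have E : (`|numq q| * b = a * `|denq q|)%N.
  apply/eqP; rewrite -eqz_nat !PoszM !abszE !gtr0_norm ?denq_gt0 ?numq_gt0//.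
  rewrite -(inj_eq (@intr_inj rat)) !rmorphM/= numqE -!pmulrn.
  by rewrite -qb mulrAC.
have n0 : (0 < `|numq q|)%N by rewrite absz_gt0 gt_eqF// numq_gt0.
have d0 : (0 < `|denq q|)%N by rewrite absz_gt0 denq_neq0.
move/(congr1 (logn p)): E; rewrite !lognM// => E.
rewrite /nu; lia.
Qed.

(** Legendre: digit i is floor(m/2^i) - 2 floor(m/2^(i+1)); summing over i and shifting the index
    yields the formula. *)
Lemma s2_logn_fact (m : nat) : (s2 m + logn 2 m`! = m)%N.
Proof.
have mod2 i : ((m %/ 2 ^ i) %% 2 + 2 * (m %/ 2 ^ i.+1) = m %/ 2 ^ i)%N.
  by rewrite expnSr divnMA; lia.
have E : (s2 m + 2 * \sum_(i < m) m %/ 2 ^ i.+1 = \sum_(i < m) m %/ 2 ^ i)%N.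
  by rewrite /s2 big_distrr/= -big_split/=; apply: eq_bigr => i _.
have L : logn 2 m`! = (\sum_(i < m) m %/ 2 ^ i.+1)%N.
  by rewrite logn_fact// big_add1/= big_mkord.
have T (f : nat -> nat) :
    (\sum_(i < m) f i + f m = f 0 + \sum_(i < m) f i.+1)%N.
  elim: (m) => [|n IHn]; first by rewrite !big_ord0 addn0.
  by rewrite !big_ord_recr/= IHn addnA.
have := T (fun i => m %/ 2 ^ i)%N.
(* The last term of the shifted sum vanishes because m < 2^m. *)
rewrite expn0 divn1 (divn_small (ltn_expl _ _))// addn0.
by rewrite -E L; lia.
Qed.

Lemma d0E (R : realType) (m : nat) :
  d R 0 m = (\prod_(j < m) (4 * j + 3))%:R / (2 ^ m * m`!)%:R.
Proof.
have [p pE] := @P_poly R m.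
have a1 : -1 < 0 :> R by lra.
(* Existence of [p] ensures that [xget] returns a polynomial representing P_m; its value at 0 is the
   constant term. *)
have /(_ 0 a1) : forall a : R, -1 < a ->
    P m a = (map_poly ratr (Ppoly R m)).[a].
  exact: (@xgetPex _ 0 [set q : {poly rat} | forall a : R, -1 < a ->
    P m a = (map_poly ratr q).[a]] (ex_intro _ p pE)).
rewrite P_at0 horner_coef0 coef_map/= -/(d R 0 m) => E.
by apply: (fmorph_inj (ratr : rat -> R)); rewrite /= -E fmorph_div/= !ratr_nat.
Qed.

Theorem theorem1 (R : realType) (m : nat) (hm : (0 < m)%N) :
  nu 2 (d R 0 m) = - (m + logn 2 m`!)%:Z
  /\ - (m + logn 2 m`!)%:Z = (s2 m)%:Z - (2 * m)%:Z.
Proof.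
(* Every factor 4j + 3 is odd, so the valuation comes from the denominator 2^m m! alone. *)
have odd_prod : odd (\prod_(j < m) (4 * j + 3)).
  elim/big_ind: _ => [//|x y|i _]; first by rewrite oddM => -> ->.
  by rewrite oddD oddM.
split.
  rewrite d0E nu_frac ?muln_gt0 ?expn_gt0 ?fact_gt0 ?(odd_gt0 odd_prod)//.
  rewrite lognM ?expn_gt0 ?fact_gt0// pfactorK//.
  by rewrite lognE/= dvdn2 odd_prod/= andbF sub0r.
have := s2_logn_fact m; lia.
Qed.
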